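(* Let $M$ denote one of the following matrices associated with a simple graph: the adjacency matrix $A$, the signless Laplacian $Q$, or the matrix $A_\alpha$ (for a fixed real $\alpha$). Let $G$ be a simple graph of order $n$ and let $H^{(v)}$ be a rooted simple graph of order $m$ with root $v$. Let $D_v$ be the $m\times m$ diagonal matrix whose only nonzero entry is a $1$ in the diagonal position corresponding to $v$, and let $B(\lambda)=M(H)+\lambda D_v$. Let $M^{(v)}(H)$ be the matrix obtained from $M(H)$ by deleting the row and column corresponding to $v$. Then \[ \det W_M(G\circ H^{(v)})=\pm \left(\mathrm{Res}\big(\phi(M(H);x),\phi(M^{(v)}(H);x)\big)\right)^{\frac{n(n-1)}{2}}\cdot\det h(M(G))\cdot\left(\det W_M(G)\right)^m, \] where $h(\lambda)=\det W(B(\lambda))=\det[e, B(\lambda)e,\ldots, (B(\lambda))^{m-1}e]$ (a polynomial in $\lambda$).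
   Context: For a graph $G$ on $n$ vertices, $A(G)$ is the adjacency matrix, $Q(G)=D(G)+A(G)$ the signless Laplacian ($D(G)$ the diagonal degree matrix), and $A_\alpha(G)=\alpha D(G)+(1-\alpha)A(G)$. For a square matrix $N$, $\phi(N;x)=\det(xI-N)$. For an $k\times k$ matrix $N$, its walk matrix is $W(N)=[e,Ne,\ldots,N^{k-1}e]$ with $e$ the all-ones vector; $W_M(G)=W(M(G))$. The rooted product $G\circ H^{(v)}$ is obtained from $G$ (vertices $1,\dots,n$) and $n$ copies of $H$ by identifying the root $v$ of the $i$th copy with vertex $i$ of $G$, for each $i$. For polynomials $f=a_N\prod_{i=1}^N(x-\alpha_i)$ and $g=b_K\prod_{j=1}^K(x-\beta_j)$, the resultant is $\mathrm{Res}(f,g)=a_N^K b_K^N\prod_{i,j}(\alpha_i-\beta_j)$. For a polynomial $h$ and square matrix $N$, $h(N)$ is the usual matrix polynomial. *)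

(* Defs.v *)
From HB Require Import structures.
From mathcomp Require Import all_boot all_order all_algebra.
From mathcomp Require Import complex.
Set Implicit Arguments.
Unset Strict Implicit.
Unset Printing Implicit Defensive.
Import GRing.Theory.
Local Open Scope ring_scope.

Record sgraph (n : nat) := SGraph {
  adj :> rel 'I_n;
  adj_sym : symmetric adj;
  adj_irrefl : irreflexive adj
}.

Section GraphMatrices.
Variables (R : nzRingType) (n : nat).
Implicit Types (G : sgraph n) (alpha : R).

Definition deg G (i : 'I_n) : nat := #|[set j | G i j]|.

Definition adj_mx G : 'M[R]_n := \matrix_(i, j) (G i j)%:R.

Definition deg_mx G : 'M[R]_n := diag_mx (\row_i (deg G i)%:R).

Definition slap_mx G : 'M[R]_n := deg_mx G + adj_mx G.

Definition alpha_mx alpha G : 'M[R]_n :=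
  alpha *: deg_mx G + (1 - alpha) *: adj_mx G.

End GraphMatrices.

Inductive mx_kind (R : Type) :=
  | MxA
  | MxQ
  | MxAalpha of R.
Arguments MxA {R}.
Arguments MxQ {R}.

Definition graph_mx (R : nzRingType) (M : mx_kind R) (n : nat) (G : sgraph n) :
    'M[R]_n :=
  match M with
  | MxA => adj_mx R G
  | MxQ => slap_mx R G
  | MxAalpha alpha => alpha_mx alpha G
  end.

Definition walk_mx (R : nzRingType) (k : nat) (N : 'M[R]_k) : 'M[R]_k :=
  \matrix_(i, j) (N ^+ j *m (const_mx 1 : 'cV[R]_k)) i 0.

(* Vertices of the rooted product are pairs (i, x), standing for the vertex x
   of the i-th copy of H; (i, v) is identified with the vertex i of G.  The pair
   (i, x) is numbered mxvec_index i x : 'I_(n * m), and pair_of is the inverse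
   of this numbering. *)
Definition pair_of (n m : nat) (k : 'I_(n * m)) : 'I_n * 'I_m :=
  enum_val (cast_ord (esym (mxvec_cast n m)) k).

Lemma pair_of_mxvec_index n m (i : 'I_n) (x : 'I_m) :
  pair_of (mxvec_index i x) = (i, x).
Proof. by rewrite /pair_of /mxvec_index cast_ordK enum_rankK. Qed.

Section RootedProduct.
Variables (n m : nat) (G : sgraph n) (H : sgraph m) (v : 'I_m).

Definition rooted_adj : rel 'I_(n * m) := fun k l =>
  let: (i, x) := pair_of k in
  let: (j, y) := pair_of l in
  ((i == j) && H x y) || [&& x == v, y == v & G i j].

Lemma rooted_adj_sym : symmetric rooted_adj.
Proof.
move=> k l; rewrite /rooted_adj.
case: (pair_of k) (pair_of l) => i x [j y].
by rewrite eq_sym (adj_sym H) (adj_sym G) andbCA.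
Qed.

Lemma rooted_adj_irrefl : irreflexive rooted_adj.
Proof.
move=> k; rewrite /rooted_adj; case: (pair_of k) => i x.
by rewrite !adj_irrefl !andbF.
Qed.

Definition rooted_product : sgraph (n * m) :=
  SGraph rooted_adj_sym rooted_adj_irrefl.

End RootedProduct.

Definition delete_vertex_mx (R : nzRingType) (m : nat) (N : 'M[R]_m) (v : 'I_m) :
    'M[R]_m.-1 :=
  row' v (col' v N).

Definition root_shift_mx (R : nzRingType) (m : nat) (N : 'M[R]_m) (v : 'I_m)
    (lambda : R) : 'M[R]_m :=
  N + lambda *: delta_mx v v.

(* det W(B(lambda)) as a polynomial: the determinant is computed over {poly R},
   with the indeterminate 'X in the place of lambda. *)
Definition walk_det_poly (R : comNzRingType) (m : nat) (N : 'M[R]_m) (v : 'I_m) :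
    {poly R} :=
  \det (walk_mx (root_shift_mx (map_mx polyC N) v 'X)).

Lemma walk_det_polyE (R : comNzRingType) (m : nat) (N : 'M[R]_m) (v : 'I_m)
    (lambda : R) :
  (walk_det_poly N v).[lambda] = \det (walk_mx (root_shift_mx N v lambda)).
Proof.
rewrite /walk_det_poly -/(horner_eval lambda _) -det_map_mx; congr (\det _).
set B := root_shift_mx _ v 'X.
have BE : map_mx (horner_eval lambda) B = root_shift_mx N v lambda.
  apply/matrixP=> i j; rewrite !mxE /horner_eval !hornerE; congr (_ + _ * _).
  by case: (_ && _); rewrite ?hornerE.
have BX k : map_mx (horner_eval lambda) (B ^+ k) = root_shift_mx N v lambda ^+ k.
  elim: k => [|k IHk]; first by rewrite !expr0 map_mx1.
  by rewrite !exprS map_mxM BE IHk.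
apply/matrixP=> i j; rewrite !mxE raddf_sum -BX; apply: eq_bigr => k _.
by rewrite !mxE !mulr1.
Qed.

(* horner_mx is only defined for sizes of the form k.+1. *)
Definition matrix_poly (R : nzRingType) (k : nat) (h : {poly R}) (N : 'M[R]_k) :
    'M[R]_k :=
  \sum_(i < size h) h`_i *: N ^+ i.

Lemma matrix_polyE (R : comNzRingType) (k : nat) (h : {poly R}) (N : 'M[R]_k.+1) :
  matrix_poly h N = horner_mx N h.
Proof.
rewrite -[in RHS](coefK h) poly_def raddf_sum; apply: eq_bigr => i _.
by rewrite /= linearZ rmorphXn /= horner_mx_X.
Qed.

Definition roots_seq (F : closedFieldType) (f : {poly F}) : seq F :=
  sval (closed_field_poly_normal f).

Definition root_resultant (F : closedFieldType) (f g : {poly F}) : F :=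
  lead_coef f ^+ (size g).-1 * lead_coef g ^+ (size f).-1 *
  \prod_(a <- roots_seq f) \prod_(b <- roots_seq g) (a - b).

(* MathComp's resultant is the determinant of a Sylvester matrix; the product
   over the roots is used here instead, the roots being taken in R[i]. *)
Definition Res (R : rcfType) (f g : {poly R}) : R[i] :=
  root_resultant (map_poly (real_complex R) f) (map_poly (real_complex R) g).

(* Main.v *)
Require Import Defs.
From HB Require Import structures.
From mathcomp Require Import all_boot all_order all_algebra.
From mathcomp Require Import complex ring zify.
Set Implicit Arguments.
Unset Strict Implicit.
Unset Printing Implicit Defensive.
Import GRing.Theory.
Local Open Scope ring_scope.

(* Put f = char_poly B and g = char_poly (B with the row and column of v deleted),
   where B = M(H).  The matrix of the rooted product is
   N = I (x) B + A (x) D_v with A = M(G), i.e. the image of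
   B(X) = B + X D_v under X |-> A.  Since the characteristic polynomial of B(X)
   is f - X g, Cayley-Hamilton gives f(N) = (A (x) I) g(N).  Hence, applying the
   nm polynomials x^j f^a g^(n-1-a) (j < m, a < n) to N and e, one gets the
   vectors g(N)^(n-1) N^j (A^a (x) I) e, whose determinant is
   det g(N)^(n-1) det h(A) (det W(A))^m, with det g(N) = +- Res(f, g)^n.  On the
   other hand it is det W(N) times the determinant of the coefficients of these
   polynomials, which is +- Res(f, g)^(n(n-1)/2) by f-adic expansion.  If
   Res(f, g) is nonzero one cancels; if f and g have a common root and n > 1, a
   nonzero polynomial of degree less than nm annihilates N, so det W(N) = 0. *)

(** * Matrix polynomials *)

Section MatrixPoly.
Variables (R : comNzRingType) (k : nat).
Implicit Types (p q : {poly R}) (A : 'M[R]_k).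

Lemma matrix_poly_wide N p A :
  (size p <= N)%N -> matrix_poly p A = \sum_(i < N) p`_i *: A ^+ i.
Proof.
move=> leN; rewrite /matrix_poly (big_ord_widen _ (fun i => p`_i *: A ^+ i) leN) big_mkcond.
by apply: eq_bigr => i _; case: ltnP => // /(nth_default 0) ->; rewrite scale0r.
Qed.

Lemma matrix_poly0 A : matrix_poly 0 A = 0.
Proof. by rewrite /matrix_poly size_poly0 big_ord0. Qed.

Lemma matrix_polyC c A : matrix_poly c%:P A = c%:M.
Proof.
rewrite (@matrix_poly_wide 1) ?size_polyC ?leq_b1 //.
by rewrite big_ord1 coefC scalemx1.
Qed.

Lemma matrix_polyX A : matrix_poly 'X A = A.
Proof.
by rewrite /matrix_poly size_polyX !big_ord_recl big_ord0 !coefX scale0r scale1r addr0 add0r.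
Qed.

Lemma matrix_polyD p q A : matrix_poly (p + q) A = matrix_poly p A + matrix_poly q A.
Proof.
rewrite (matrix_poly_wide _ (size_polyD p q)) (matrix_poly_wide _ (leq_maxl (size p) (size q))).
rewrite (matrix_poly_wide _ (leq_maxr (size p) (size q))) -big_split.
by apply: eq_bigr => i _; rewrite coefD scalerDl.
Qed.

Lemma matrix_polyB p q A : matrix_poly (p - q) A = matrix_poly p A - matrix_poly q A.
Proof.
by apply/eqP; rewrite eq_sym subr_eq -matrix_polyD subrK.
Qed.

Lemma matrix_polyM p q A : matrix_poly (p * q) A = matrix_poly p A *m matrix_poly q A.
Proof.
case: k A => [|k'] A; first by rewrite !thinmx0.
by rewrite !matrix_polyE rmorphM.
Qed.

Lemma matrix_polyXn p i A : matrix_poly (p ^+ i) A = matrix_poly p A ^+ i.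
Proof.
elim: i => [|i IHi]; first by rewrite matrix_polyC.
by rewrite !exprS matrix_polyM IHi.
Qed.

Lemma horner_char_poly A c : (char_poly A).[c] = \det (c%:M - A).
Proof.
rewrite -/(horner_eval c _) -det_map_mx; congr (\det _).
by apply/matrixP=> i j; rewrite !mxE /= /horner_eval !(hornerE, hornerMn).
Qed.

(** Each factor A - bI has determinant (-1)^k det(bI - A). This turns the determinant of a
    polynomial in a matrix into values of its characteristic polynomial; it is used both for g(N)
    and for multiplication modulo f. *)
Lemma det_matrix_poly_prod (s : seq R) A :
  \det (matrix_poly (\prod_(b <- s) ('X - b%:P)) A) =
    \prod_(b <- s) ((-1) ^+ k * (char_poly A).[b]).
Proof.
elim: s => [|b s IHs]; first by rewrite !big_nil matrix_polyC det1.
rewrite !big_cons matrix_polyM det_mulmx IHs; congr (_ * _).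
by rewrite matrix_polyB matrix_polyX matrix_polyC horner_char_poly -detZ scaleN1r opprB.
Qed.

Lemma matrix_poly_conj (P A U : 'M[R]_k) p :
  P *m A = U *m P -> P *m matrix_poly p A = matrix_poly p U *m P.
Proof.
move=> PA; rewrite /matrix_poly mulmx_sumr mulmx_suml; apply: eq_bigr => i _.
rewrite -scalemxAl -scalemxAr; congr (_ *: _).
elim: (i : nat) => [|j IHj]; first by rewrite !expr0 mulmx1 mul1mx.
by rewrite [A ^+ _]exprSr [U ^+ _]exprSr mulmxA IHj -!mulmxA PA.
Qed.

(** Both claims go through one induction, because diagonals multiply entrywise only for triangular
    factors. *)
Lemma matrix_poly_trig A p : is_trig_mx A ->
  is_trig_mx (matrix_poly p A) /\ forall i, matrix_poly p A i i = p.[A i i].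
Proof.
move=> /is_trig_mxP Atrig.
elim/poly_ind: p => [|p c [/is_trig_mxP IHt IHd]].
  rewrite matrix_poly0; split; first exact: mx0_is_trig.
  by move=> i; rewrite mxE horner0.
rewrite matrix_polyD matrix_polyM matrix_polyX matrix_polyC.
split=> [|i]; last first.
  rewrite !mxE eqxx !hornerE (bigD1 i) //= IHd big1 ?addr0 // => j.
  rewrite neq_ltn => /orP[] lij; first by rewrite Atrig ?mulr0.
  by rewrite IHt ?mul0r.
apply/is_trig_mxP=> i j lij; rewrite !mxE -val_eqE ltn_eqF //= addr0.
apply: big1 => l _; have [il|li] := ltnP i l; first by rewrite IHt ?mul0r.
by rewrite Atrig ?mulr0 // (leq_ltn_trans li).
Qed.

End MatrixPoly.

(** * Block matrices indexed by pairs *)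

(** The explicit numbering lets the first m indices be split off as a block, and identifies the pair
    (b, y) with the degree bm + y of x^y f^b. *)
Lemma mxvec_indexE n m (i : 'I_n) (x : 'I_m) : mxvec_index i x = (i * m + x)%N :> nat.
Proof.
rewrite /mxvec_index /= /enum_rank enum_rank_in.unlock insubdK; last first.
  by rewrite cardE -topredE /= index_mem mem_enum.
rewrite enumT unlock /= /prod_enum.
have idx (T U : eqType) (a : T) (b : U) s t : b \in t -> a \in s ->
    index (a, b) [seq (x1, x2) | x1 <- s, x2 <- t] = (index a s * size t + index b t)%N.
  move=> bt; elim: s => //= c s IHs; rewrite inE index_cat size_map.
  have [-> _|ac /=] := eqVneq c a.
    by rewrite map_f // index_map // => ? ? [].
  move=> /IHs ->; case: ifP => [/mapP[? _ [ca]]|_].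
    by rewrite ca eqxx in ac.
  by rewrite mulSn addnA.
by rewrite idx ?mem_enum // size_enum_ord !index_enum_ord.
Qed.

Lemma mxvec_index_inj n m (i j : 'I_n) (x y : 'I_m) :
  (mxvec_index i x == mxvec_index j y) = ((i, x) == (j, y)).
Proof.
apply/eqP/eqP => [|[-> ->] //].
by rewrite -!Defs.pair_of_mxvec_index => ->.
Qed.

Lemma big_mxvec (V : nmodType) n m (F : 'I_(n * m) -> V) :
  \sum_k F k = \sum_i \sum_x F (mxvec_index i x).
Proof.
rewrite pair_bigA /= (reindex _ (curry_mxvec_bij _ _)) /=.
by apply: eq_bigr => -[].
Qed.

Lemma det_block_utrig (R : comNzRingType) n m (X : 'M[R]_(n * m)) :
  (forall (i j : 'I_n) x y, (j < i)%N -> X (mxvec_index i x) (mxvec_index j y) = 0) ->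
  \det X = \prod_i \det (\matrix_(x, y) X (mxvec_index i x) (mxvec_index i y)).
Proof.
elim: n X => [|n IHn] X Xtrig.
  by rewrite big_ord0 det_mx00.
(* [n.+1 * m] is convertible to [m + n * m], so X can be read as a two-by-two block matrix. *)
pose X' : 'M[R]_(m + n * m) := X.
have il (x : 'I_m) : lshift (n * m) x = mxvec_index (ord0 : 'I_n.+1) x.
  by apply: ord_inj; apply/esym/(etrans (mxvec_indexE _ _)).
have ir (i : 'I_n) (x : 'I_m) : rshift m (mxvec_index i x) = mxvec_index (lift ord0 i) x.
  apply: ord_inj; apply/esym/(etrans (mxvec_indexE _ _)).
  by rewrite -[RHS]/(m + mxvec_index i x)%N mxvec_indexE /= /bump leq0n mulSn addnA.
rewrite -[LHS]/(\det X') -[X']submxK (_ : dlsubmx X' = 0); last first.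
  apply/matrixP=> k x; case/mxvec_indexP: k => i y; rewrite !mxE ir il.
  exact: Xtrig.
rewrite det_ublock big_ord_recl; congr (_ * _).
  by congr (\det _); apply/matrixP=> x y; rewrite !mxE !il.
rewrite IHn => [|i j x y ji]; last by rewrite !mxE !ir Xtrig.
by apply: eq_bigr => i _; congr (\det _); apply/matrixP=> x y; rewrite !mxE !ir.
Qed.

Lemma det_block_ltrig (R : comNzRingType) n m (X : 'M[R]_(n * m)) :
  (forall (i j : 'I_n) x y, (i < j)%N -> X (mxvec_index i x) (mxvec_index j y) = 0) ->
  \det X = \prod_i \det (\matrix_(x, y) X (mxvec_index i x) (mxvec_index i y)).
Proof.
move=> Xtrig; rewrite -det_tr det_block_utrig => [|i j x y ji]; last by rewrite mxE Xtrig.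
apply: eq_bigr => i _; rewrite -[RHS]det_tr; congr (\det _).
by apply/matrixP=> x y; rewrite !mxE.
Qed.

(** * Substitution of a matrix for the indeterminate *)

Section PolyBlocks.
Variables (R : comNzRingType) (n m : nat).
Implicit Types (A : 'M[R]_n) (w : 'M[{poly R}]_m).

(* The image of w under the substitution of A for the indeterminate. *)
Definition poly_blocks A w : 'M[R]_(n * m) :=
  \matrix_(k, l) matrix_poly (w (pair_of k).2 (pair_of l).2) A (pair_of k).1 (pair_of l).1.

Lemma poly_blocksE A w i x j y :
  poly_blocks A w (mxvec_index i x) (mxvec_index j y) = matrix_poly (w x y) A i j.
Proof. by rewrite mxE !Defs.pair_of_mxvec_index. Qed.

Lemma eq_mxvec (X Y : 'M[R]_(n * m)) :
  (forall i x j y, X (mxvec_index i x) (mxvec_index j y) = Y (mxvec_index i x) (mxvec_index j y))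
  -> X = Y.
Proof.
by move=> XY; apply/matrixP=> k l; case/mxvec_indexP: k => i x; case/mxvec_indexP: l.
Qed.

Lemma matrix_poly_sum A I r (P : pred I) (F : I -> {poly R}) :
  matrix_poly (\sum_(i <- r | P i) F i) A = \sum_(i <- r | P i) matrix_poly (F i) A.
Proof.
rewrite (@big_morph _ _ (fun p : {poly R} => matrix_poly p A) 0 +%R 0 +%R) // => [p q|].
  exact: matrix_polyD.
by rewrite matrix_poly0.
Qed.

Lemma poly_blocksB A w1 w2 : poly_blocks A (w1 - w2) = poly_blocks A w1 - poly_blocks A w2.
Proof. by apply: eq_mxvec => i x j y; rewrite !mxE matrix_polyB !mxE. Qed.

Lemma poly_blocksD A w1 w2 : poly_blocks A (w1 + w2) = poly_blocks A w1 + poly_blocks A w2.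
Proof. by apply: eq_mxvec => i x j y; rewrite !mxE matrix_polyD !mxE. Qed.

(** Evaluation of polynomials at A is multiplicative, hence so is its entrywise extension to
    matrices of polynomials. *)
Lemma poly_blocksM A w1 w2 : poly_blocks A (w1 *m w2) = poly_blocks A w1 *m poly_blocks A w2.
Proof.
apply: eq_mxvec => i x j y; rewrite poly_blocksE !mxE matrix_poly_sum summxE big_mxvec.
rewrite exchange_big; apply: eq_bigr => z _; rewrite matrix_polyM !mxE.
by apply: eq_bigr => l _; rewrite !poly_blocksE.
Qed.

Lemma poly_blocks_scalar A p i x j y :
  poly_blocks A p%:M (mxvec_index i x) (mxvec_index j y) = matrix_poly p A i j *+ (x == y).
Proof.
rewrite poly_blocksE mxE; case: eqP => _ //.
by rewrite mulr0n matrix_poly0 mxE.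
Qed.

Lemma poly_blocksC A c : poly_blocks A c%:P%:M = c%:M.
Proof.
apply: eq_mxvec => i x j y; rewrite poly_blocks_scalar matrix_polyC !mxE mxvec_index_inj.
by rewrite xpair_eqE; do 2!case: (_ == _).
Qed.

Lemma poly_blocks_poly A w (p : {poly R}) :
  poly_blocks A (matrix_poly (map_poly polyC p) w) = matrix_poly p (poly_blocks A w).
Proof.
elim/poly_ind: p => [|p c IHp].
  by rewrite map_poly0 !matrix_poly0 -(subrr 0) poly_blocksB subrr.
rewrite rmorphD rmorphM /= map_polyX map_polyC /= !matrix_polyD !matrix_polyM !matrix_polyC.
by rewrite !matrix_polyX poly_blocksD poly_blocksM IHp poly_blocksC.
Qed.

End PolyBlocks.

Lemma det_poly_blocks (C : numClosedFieldType) n m (A : 'M[C]_n) (w : 'M[{poly C}]_m) :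
  \det (poly_blocks A w) = \det (matrix_poly (\det w) A).
Proof.
(* By Schur triangularization A may be taken triangular, and then poly_blocks A w
   is block triangular with diagonal blocks w evaluated at the eigenvalues. *)
case: n A => [|n] A; first by rewrite !det_mx00.
have [P /unitarymx_unit Pu] := Schur A isT.
rewrite /similar_to conjumx // => Utrig; set U := P *m A *m _ in Utrig.
have PA : P *m A = U *m P by rewrite /U mulmxKV.
clearbody U.
have PdetE p : \det (matrix_poly p A) = \det (matrix_poly p U).
  have /(congr1 determinant) := matrix_poly_conj p PA.
  rewrite !det_mulmx mulrC => /mulIf -> //.
  by move: Pu; rewrite unitmxE unitfE.
rewrite PdetE.
(* [T Q] is the Kronecker product Q (x) I; conjugation by [T P] replaces A by U in every block at
   once. *)
pose T (Q : 'M[C]_n.+1) := poly_blocks Q ('X%:M : 'M_m).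
have TE Q i x j y : T Q (mxvec_index i x) (mxvec_index j y) = Q i j *+ (x == y).
  by rewrite poly_blocks_scalar matrix_polyX.
have TT : T P *m T (invmx P) = 1%:M.
  apply: eq_mxvec => i x j y; rewrite !mxE big_mxvec exchange_big /= (bigD1 x) //=.
  under eq_bigr do rewrite !TE eqxx mulr1n.
  rewrite [X in _ + X]big1 => [|z zx]; last first.
    by apply: big1 => l _; rewrite !TE [x == z]eq_sym (negPf zx) mul0r.
  rewrite addr0 mxvec_index_inj xpair_eqE.
  under eq_bigr do rewrite mulrnAr.
  rewrite sumrMnl.
  have /matrixP/(_ i j) := mulmxV Pu; rewrite !mxE => ->.
  by do 2!case: (_ == _).
have TPhi : T P *m poly_blocks A w = poly_blocks U w *m T P.
  apply: eq_mxvec => i x j y; rewrite !mxE !big_mxvec [in RHS]exchange_big [in LHS]exchange_big /=.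
  rewrite (bigD1 x) //= [in RHS](bigD1 y) //= [X in _ + X]big1 => [|z zx]; last first.
    by apply: big1 => l _; rewrite !TE [x == z]eq_sym (negPf zx) mul0r.
  rewrite [X in _ = _ + X]big1 => [|z zx]; last first.
    by apply: big1 => l _; rewrite !TE (negPf zx) mulr0.
  rewrite !addr0.
  under eq_bigr do rewrite TE eqxx poly_blocksE.
  under [in RHS]eq_bigr do rewrite TE eqxx poly_blocksE.
  by have /matrixP/(_ i j) := matrix_poly_conj (w x y) PA; rewrite !mxE.
have TPn0 : \det (T P) != 0.
  by have /mulmx1_unit[] := TT; rewrite unitmxE unitfE.
have -> : \det (poly_blocks A w) = \det (poly_blocks U w).
  by have /(congr1 determinant) := TPhi; rewrite !det_mulmx mulrC => /mulIf ->.
rewrite det_block_ltrig => [|i j x y lij]; last first.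
  by rewrite poly_blocksE; have [/is_trig_mxP ->] := matrix_poly_trig (w x y) Utrig.
have [/det_trig -> dE] := matrix_poly_trig (\det w) Utrig.
apply: eq_bigr => i _; rewrite dE -/(horner_eval _ _) -det_map_mx; congr (\det _).
apply/matrixP=> x y; rewrite !mxE !Defs.pair_of_mxvec_index /= /horner_eval.
by have [_ ->] := matrix_poly_trig (w x y) Utrig.
Qed.

(** * Mixed powers of two polynomials *)

Lemma det_mxX (R : comNzRingType) k (A : 'M[R]_k) i : \det (A ^+ i) = \det A ^+ i.
Proof.
elim: i => [|i IHi]; first by rewrite !expr0 det1.
by rewrite !exprS -IHi -det_mulmx.
Qed.

Section Family.
Variables (F : fieldType) (m : nat) (f : {poly F}).
Hypotheses (f_monic : f \is monic) (size_f : size f = m.+1).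

(* The matrix of multiplication by q modulo f, acting on row vectors. *)
Definition mod_mx (q : {poly F}) : 'M[F]_m :=
  \matrix_(i, j) (('X^i * q) %% f)`_j.

Let f_neq0 : f != 0. Proof. exact: monic_neq0. Qed.

Let size_fX a : size (f ^+ a) = (a * m).+1.
Proof. by rewrite polySpred ?expf_neq0 // size_exp size_f mulnC. Qed.

Let size_mod p : (size (p %% f)%R <= m)%N.
Proof. by rewrite -ltnS -size_f ltn_modp. Qed.

Let mod_mulm p q : (p %% f * q) %% f = (p * q) %% f.
Proof.
by rewrite [in RHS](divp_eq p f) mulrDl modpD mulrAC modp_mull add0r.
Qed.

Let mod_expand p : p %% f = \sum_(y < m) (p %% f)`_y *: 'X^y.
Proof.
rewrite -poly_def; apply/polyP=> i; rewrite coef_poly; case: ltnP => // mi.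
by rewrite nth_default // (leq_trans _ mi).
Qed.

(** Multiplication by q on F[x]/(f) is q evaluated at multiplication by x. *)
Lemma mod_mxE q : mod_mx q = matrix_poly q (mod_mx 'X).
Proof.
elim/poly_ind: q => [|q c IHq].
  by rewrite matrix_poly0; apply/matrixP=> i j; rewrite !mxE mulr0 mod0p coef0.
rewrite matrix_polyD matrix_polyM matrix_polyX matrix_polyC -IHq.
apply/matrixP=> i j; rewrite !mxE mulrDr modpD coefD; congr (_ + _).
  rewrite mulrA -mod_mulm [('X^i * q) %% f]mod_expand mulr_suml.
  rewrite (big_morph (fun p => p %% f) (modpD f) (mod0p f)) coef_sum.
  by apply: eq_bigr => y _; rewrite -scalerAl modpZl coefZ !mxE.
rewrite modp_small; last first.
  by rewrite mulrC mul_polyC (leq_ltn_trans (size_scale_leq _ _)) // size_polyXn size_f ltnS.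
by rewrite mulrC mul_polyC coefZ coefXn mulr_natr eq_sym.
Qed.

(** Multiplication by x is the companion matrix of f: only x^(m-1) is sent to a power that needs
    reduction, giving the last row. *)
Lemma char_poly_mod_mx : char_poly (mod_mx 'X) = f.
Proof.
rewrite -[RHS](companionmxK f_monic).
have em : m = (size f).-1 by rewrite size_f.
have coefmod (i : nat) (j : nat) : (i < m)%N -> (j < m)%N ->
    (('X^i * 'X) %% f)`_j = if i == m.-1 then - f`_j else (i.+1 == j)%:R.
  move=> im jm; rewrite -exprSr; case: eqP => [->|/eqP neq].
    rewrite prednK ?(leq_ltn_trans _ im) //.
    rewrite -[X in X %% f](subrK f) modpD modpp addr0 modp_small.
      by rewrite coefB coefXn ltn_eqF // sub0r.
    rewrite size_f ltnS -opprB size_polyN; apply/leq_sizeP=> l ml.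
    rewrite coefB coefXn; have [->|lm] := eqVneq l m.
      by move: f_monic; rewrite monicE lead_coefE size_f => /eqP ->; rewrite subrr.
    by rewrite nth_default ?subrr // size_f ltn_neqAle eq_sym lm.
  rewrite modp_small ?coefXn 1?eq_sym //.
  by rewrite size_polyXn size_f !ltnS; lia.
(* The companion matrix has size [(size f).-1], so m is rewritten to this number before entries are
   compared. *)
move: coefmod; clear -em; rewrite /mod_mx; move: em => -> coefmod.
by congr char_poly; apply/matrixP=> i j; rewrite !mxE coefmod.
Qed.

Lemma det_mod_mx (s : seq F) :
  \det (mod_mx (\prod_(b <- s) ('X - b%:P))) = \prod_(b <- s) ((-1) ^+ m * f.[b]).
Proof. by rewrite mod_mxE det_matrix_poly_prod char_poly_mod_mx. Qed.

Lemma mod_mxX q i : mod_mx (q ^+ i) = mod_mx q ^+ i.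
Proof. by rewrite mod_mxE matrix_polyXn -mod_mxE. Qed.

Lemma adic_expansion n (p : {poly F}) : (size p <= n * m)%N ->
  p = \sum_(b < n) (p %/ f ^+ b) %% f * f ^+ b.
Proof.
elim: n p => [|n IHn] p; first by rewrite size_poly_leq0 big_ord0 => /eqP.
move=> szp; rewrite big_ord_recl expr0 divp1 mulr1 [LHS](divp_eq p f) addrC; congr (_ + _).
rewrite [p %/ f in LHS]IHn ?size_divp ?size_f //=; last by rewrite leq_subLR.
rewrite mulr_suml; apply: eq_bigr => b _.
by rewrite divp_divl -exprS -mulrA -exprSr.
Qed.

(** The total exponent of f and g is always n - 1, so trading each f(N) for g(N) leaves the common
    factor g(N)^(n-1). With g = 1 this is the f-adic basis x^j f^a. *)
Definition mixed_powers n (g : {poly F}) (k : 'I_(n * m)) : {poly F} :=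
  'X^((pair_of k).2) * f ^+ (pair_of k).1 * g ^+ (n.-1 - (pair_of k).1).

Lemma size_mixed_powers n (g : {poly F}) k : (size g <= m)%N ->
  (size (@mixed_powers n g k) <= n * m)%N.
Proof.
move=> szg; case/mxvec_indexP: k => a j.
rewrite /mixed_powers Defs.pair_of_mxvec_index /=.
apply: leq_trans (size_polyMleq _ _) _.
have [lej lea] := (ltn_ord j, ltn_ord a).
have -> : size ('X^j * f ^+ a) = (j + a * m).+1.
  by rewrite size_monicM ?monicXn ?expf_neq0 // size_polyXn size_fX addSn addnS.
have := size_poly_exp_leq g (n.-1 - a).
have : ((size g).-1 * (n.-1 - a) <= m * (n.-1 - a))%N by rewrite leq_mul2r; lia.
have -> : (n * m = (a * m + m * (n.-1 - a)) + m)%N.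
  by rewrite [(m * _)%N]mulnC -mulnDl -mulSnr; congr (_ * _)%N; lia.
by lia.
Qed.

Definition coef_mx N (p : 'I_N -> {poly F}) : 'M[F]_N := \matrix_(k, s) (p k)`_s.

Lemma det_mixed_powers n (g : {poly F}) : (size g <= m)%N ->
  \det (coef_mx (@mixed_powers n g)) = \det (mod_mx g) ^+ 'C(n, 2).
Proof.
move=> szg; set T := coef_mx _.
(* Z holds the coordinates on the unitriangular basis x^y f^b, whose coefficient
   matrix is V; it is block triangular with diagonal blocks mod_mx (g ^+ (n-1-a)). *)
pose V := coef_mx (@mixed_powers n 1).
pose Z : 'M[F]_(n * m) := \matrix_(k, l)
  ((mixed_powers g k %/ f ^+ (pair_of l).1) %% f)`_(pair_of l).2.
have VE b y s : V (mxvec_index b y) s = ('X^y * f ^+ b)`_s.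
  by rewrite mxE /mixed_powers Defs.pair_of_mxvec_index /= expr1n mulr1.
have szV (b : 'I_n) (y : 'I_m) : size ('X^y * f ^+ b) = (mxvec_index b y).+1.
  rewrite mxvec_indexE size_monicM ?monicXn ?expf_neq0 // size_polyXn size_fX.
  by rewrite addSn addnS addnC.
have ->: T = Z *m V.
  apply/matrixP=> k s; rewrite !mxE.
  rewrite [in LHS](adic_expansion (size_mixed_powers k szg)) coef_sum big_mxvec.
  apply: eq_bigr => b _; rewrite mod_expand mulr_suml coef_sum.
  apply: eq_bigr => y _; rewrite VE mxE Defs.pair_of_mxvec_index /=.
  by rewrite -scalerAl coefZ.
have detV : \det V = 1.
  rewrite det_trig; last first.
    apply/is_trig_mxP=> k s; case/mxvec_indexP: k => b y ks.
    by rewrite VE nth_default // szV.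
  apply: big1 => k _; case/mxvec_indexP: k => b y; rewrite VE.
  have : 'X^y * f ^+ b \is monic by rewrite monicMr ?monicXn ?monic_exp.
  by rewrite monicE lead_coefE szV => /eqP.
rewrite det_mulmx detV mulr1 det_block_utrig => [|a b x y ba]; last first.
  rewrite mxE /mixed_powers !Defs.pair_of_mxvec_index /=.
  (* For b < a the polynomial is divisible by f^(b+1), so its f-adic digit at b vanishes. *)
  have -> : f ^+ a = f ^+ (a - b).-1 * f * f ^+ b.
    by rewrite -exprSr -exprD; congr (_ ^+ _); lia.
  rewrite [X in (X %/ _)](_ : _ = ('X^x * f ^+ (a - b).-1 * g ^+ (n.-1 - a)) * f * f ^+ b).
    by rewrite mulpK ?expf_neq0 // modp_mull coef0.
  by ring.
transitivity (\prod_(a < n) \det (mod_mx g) ^+ (n.-1 - a)).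
  apply: eq_bigr => a _; rewrite -det_mxX -mod_mxX; congr (\det _).
  apply/matrixP=> x y; rewrite !mxE /mixed_powers !Defs.pair_of_mxvec_index /=.
  by rewrite mulrAC mulpK ?expf_neq0.
(* The exponents n - 1 - a run through 0, ..., n - 1 in reverse and add up to ['C(n, 2)]. *)
rewrite prodrXr; congr (_ ^+ _).
rewrite -bin2_sum big_mkord (reindex_inj rev_ord_inj).
by apply: eq_bigr => i _ /=; have := ltn_ord i; lia.
Qed.

End Family.

(** * The shifted matrix B + X D_v *)

(** The determinant is linear in row v; the second term replaces that row by the unit vector at
    v. *)
Lemma det_add_delta (R : comNzRingType) m (X : 'M[R]_m) (v : 'I_m) c :
  \det (X + c *: delta_mx v v) = \det X + c * \det (row' v (col' v X)).
Proof.
pose Y := \matrix_(i, j) if i == v then (j == v)%:R else X i j.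
rewrite (@determinant_multilinear _ _ _ X Y v 1 c) ?mul1r; first last.
- by apply/matrixP=> i j; rewrite !mxE eq_sym (negPf (neq_lift _ _)) mulr0 addr0.
- by apply/matrixP=> i j; rewrite !mxE [lift _ _ == _]eq_sym (negPf (neq_lift _ _)) mulr0 addr0.
- by apply/matrixP=> i j; rewrite !mxE eqxx mul1r.
congr (_ + _ * _); rewrite (expand_det_row _ v) (bigD1 v) //= big1 => [|j jv]; last first.
  by rewrite mxE eqxx (negPf jv) mul0r.
rewrite mxE !eqxx mul1r addr0 /cofactor addnn -signr_odd odd_double mul1r.
congr (\det _); apply/matrixP=> i j.
by rewrite !mxE [lift _ _ == _]eq_sym (negPf (neq_lift _ _)).
Qed.

Section RootShift.
Variable R : comNzRingType.

Lemma char_poly_root_shift m (B : 'M[R]_m) (v : 'I_m) c :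
  char_poly (root_shift_mx B v c) = char_poly B - c *: char_poly (delete_vertex_mx B v).
Proof.
rewrite /char_poly /delete_vertex_mx -row'_col'_char_poly_mx -mul_polyC -mulNr.
rewrite -det_add_delta.
congr (\det _); apply/matrixP=> i j; rewrite !mxE rmorphD rmorphM /= opprD addrA.
by rewrite mulNr rmorph_nat.
Qed.

Lemma matrix_poly_char_poly k (A : 'M[R]_k) : matrix_poly (char_poly A) A = 0.
Proof. by case: k A => [|k] A; rewrite ?thinmx0 // matrix_polyE Cayley_Hamilton. Qed.

Lemma matrix_polyZ k c (p : {poly R}) (A : 'M[R]_k) :
  matrix_poly (c *: p) A = c *: matrix_poly p A.
Proof. by rewrite -mul_polyC matrix_polyM matrix_polyC mul_scalar_mx. Qed.

(** The columns of the walk matrix are the A^s e, so the walk matrix takes the coefficient vector of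
    p to p(A)e. *)
Lemma walk_coef_mx N (A : 'M[R]_N) (p : {poly R}) :
  (size p <= N)%N ->
  walk_mx A *m (\col_s p`_s) = matrix_poly p A *m const_mx 1.
Proof.
move=> szp; apply/matrixP=> k l; rewrite (matrix_poly_wide _ szp) mulmx_suml.
rewrite !mxE summxE; apply: eq_bigr => s _.
by rewrite -scalemxAl !mxE mulrC ord1.
Qed.

End RootShift.

(** * Polynomials in the generic shift *)

Section PolyRootShift.
Variables (R : comNzRingType) (m : nat) (B : 'M[R]_m) (v : 'I_m).

Definition generic_shift : 'M[{poly R}]_m := root_shift_mx (map_mx polyC B) v 'X.

Definition shift_poly (p : {poly R}) := matrix_poly (map_poly polyC p) generic_shift.

Lemma shift_polyM p q : shift_poly (p * q) = shift_poly p *m shift_poly q.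
Proof. by rewrite /shift_poly rmorphM matrix_polyM. Qed.

Lemma shift_polyX i : shift_poly 'X^i = generic_shift ^+ i.
Proof. by rewrite /shift_poly rmorphXn /= map_polyX matrix_polyXn matrix_polyX. Qed.

Lemma shift_polyB p q : shift_poly (p - q) = shift_poly p - shift_poly q.
Proof. by rewrite /shift_poly rmorphB matrix_polyB. Qed.

Lemma shift_polyZ c p : shift_poly (c *: p) = c%:P *: shift_poly p.
Proof. by rewrite /shift_poly map_polyZ matrix_polyZ. Qed.

Lemma char_poly_generic_shift :
  char_poly generic_shift = map_poly polyC (char_poly B)
    - 'X *: map_poly polyC (char_poly (delete_vertex_mx B v)).
Proof.
rewrite char_poly_root_shift !map_char_poly /delete_vertex_mx.
by rewrite map_row' map_col'.
Qed.

(** Cayley-Hamilton for B(X), whose characteristic polynomial is f - X g. *)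
Lemma shift_poly_char_poly :
  shift_poly (char_poly B) = 'X *: shift_poly (char_poly (delete_vertex_mx B v)).
Proof.
apply/eqP; rewrite -subr_eq0 /shift_poly -matrix_polyZ -matrix_polyB.
by rewrite -char_poly_generic_shift matrix_poly_char_poly.
Qed.

Lemma shift_poly_char_polyX a p :
  shift_poly (char_poly B ^+ a * p) =
    'X^a *: shift_poly (char_poly (delete_vertex_mx B v) ^+ a * p).
Proof.
elim: a p => [|a IHa] p; first by rewrite !expr0 scale1r.
rewrite !exprSr -!mulrA IHa mulrCA shift_polyM shift_poly_char_poly.
by rewrite -scalemxAl scalerA -exprSr -shift_polyM mulrCA.
Qed.

Lemma det_generic_shift c :
  \det (c%:P%:M - generic_shift) =
    (char_poly B).[c]%:P - (char_poly (delete_vertex_mx B v)).[c] *: 'X.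
Proof.
rewrite -horner_char_poly char_poly_generic_shift hornerD hornerN hornerZ !horner_map /=.
by rewrite mulrC mul_polyC.
Qed.

Variables (n : nat) (A : 'M[R]_n).

Lemma poly_blocksZ p (w : 'M[{poly R}]_m) :
  poly_blocks A (p *: w) = poly_blocks A p%:M *m poly_blocks A w.
Proof. by rewrite -poly_blocksM mul_scalar_mx. Qed.

Lemma poly_blocks_shift p :
  poly_blocks A (shift_poly p) = matrix_poly p (poly_blocks A generic_shift).
Proof. exact: poly_blocks_poly. Qed.

(** The last factor is W(A) (x) I, with column A^a e (x) e_j at (a, j). The factor before it maps
    this column to N^j (A^a (x) I) e, where N is the image of the generic shift. *)
Lemma poly_blocks_walk (i : 'I_n) (x : 'I_m) (a : 'I_n) (j : 'I_m) :
  (poly_blocks A ('X^a *: generic_shift ^+ j) *m (const_mx 1 : 'cV_(n * m)))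
    (mxvec_index i x) 0 =
  (poly_blocks A (walk_mx generic_shift) *m poly_blocks (walk_mx A) ('X%:M))
    (mxvec_index i x) (mxvec_index a j).
Proof.
have : forall x j, walk_mx generic_shift x j = \sum_y (generic_shift ^+ j) x y.
  by move=> x' j'; rewrite !mxE; apply: eq_bigr => y _; rewrite mxE mulr1.
move: (walk_mx generic_shift) => w wE.
have -> : (poly_blocks A w *m poly_blocks (walk_mx A) ('X%:M))
    (mxvec_index i x) (mxvec_index a j) =
    (matrix_poly (w x j * 'X^a) A *m (const_mx 1 : 'cV_n)) i 0.
  rewrite matrix_polyM matrix_polyXn matrix_polyX -mulmxA !mxE big_mxvec.
  apply: eq_bigr => l _; rewrite (bigD1 j) //= big1 => [|y yj]; last first.
    by rewrite poly_blocks_scalar (negPf yj) mulr0.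
  rewrite addr0 poly_blocks_scalar eqxx mulr1n poly_blocksE matrix_polyX.
  by rewrite [walk_mx A l a]mxE.
rewrite !mxE big_mxvec; apply: eq_bigr => l _; rewrite !mxE mulr1.
under eq_bigr do rewrite poly_blocksE !mxE mulr1.
by rewrite wE -summxE -matrix_poly_sum -mulr_sumr mulrC.
Qed.

End PolyRootShift.

(** * The walk determinant *)

Lemma prodr_const_seq (R : pzSemiRingType) (I : Type) (s : seq I) (x : R) :
  \prod_(i <- s) x = x ^+ size s.
Proof. by elim: s => [|i s IHs]; rewrite ?big_nil // big_cons IHs exprS. Qed.

Section Resultant.
Variable F : closedFieldType.
Implicit Types f g : {poly F}.

Lemma roots_seqE f : f \is monic -> f = \prod_(a <- roots_seq f) ('X - a%:P).
Proof.
move=> /monicP f1; rewrite /roots_seq; case: closed_field_poly_normal => r /=.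
by rewrite f1 scale1r.
Qed.

(** Each f(b) is the product of the b - a over the roots a of f; one sign per pair of roots turns
    these into a - b. *)
Lemma root_resultant_sign f g : f \is monic -> g \is monic ->
  exists e, root_resultant f g = (-1) ^+ e * \prod_(b <- roots_seq g) f.[b].
Proof.
move=> f_monic g_monic; exists (size (roots_seq f) * size (roots_seq g))%N.
rewrite /root_resultant (monicP f_monic) (monicP g_monic) !expr1n !mul1r exchange_big /=.
rewrite exprM -prodr_const_seq -big_split /=; apply: eq_bigr => b _.
rewrite [X in X.[b]](roots_seqE f_monic) horner_prod -prodr_const_seq -big_split /=.
by apply: eq_bigr => a _; rewrite hornerXsubC mulN1r opprB.
Qed.

End Resultant.

(** * The identity over an algebraically closed field *)

Section WalkDeterminant.
Variables (C : numClosedFieldType) (n m : nat) (A : 'M[C]_n) (B : 'M[C]_m) (v : 'I_m).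

Let f := char_poly B.
Let g := char_poly (delete_vertex_mx B v).
Let N : 'M[C]_(n * m) := poly_blocks A (generic_shift B v).

Let f_monic : f \is monic. Proof. exact: char_poly_monic. Qed.
Let g_monic : g \is monic. Proof. exact: char_poly_monic. Qed.
Let size_f : size f = m.+1. Proof. exact: size_char_poly. Qed.
Let m_gt0 : (0 < m)%N. Proof. exact: leq_ltn_trans (ltn_ord v). Qed.
Let size_g : size g = m. Proof. by rewrite size_char_poly prednK. Qed.

(** Column (a, j) on the left is (x^j f^a g^(n-1-a))(N) e. Replacing f(N)^a by (A^a (x) I) g(N)^a
    completes the power of g(N) to n - 1 for every a. *)
Lemma walk_mixed_powers :
  walk_mx N *m (coef_mx (@mixed_powers _ _ f n g))^T =
    matrix_poly g N ^+ n.-1 *m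
      (poly_blocks A (walk_mx (generic_shift B v)) *m poly_blocks (walk_mx A) ('X%:M)).
Proof.
have eq_col (X Y : 'M[C]_(n * m)) : (forall l, col l X = col l Y) -> X = Y.
  by move=> XY; apply/matrixP=> k l; have /colP/(_ k) := XY l; rewrite !mxE.
apply: eq_col => l; case/mxvec_indexP: l => a j.
set p := mixed_powers f g (mxvec_index a j).
have -> : col (mxvec_index a j) (walk_mx N *m (coef_mx (mixed_powers f g))^T) =
    walk_mx N *m \col_s p`_s.
  by rewrite !colE -mulmxA -colE; congr (_ *m _); apply/colP=> s; rewrite !mxE.
rewrite walk_coef_mx ?size_mixed_powers ?size_g // /N -poly_blocks_shift.
have -> : p = f ^+ a * (g ^+ (n.-1 - a) * 'X^j).
  by rewrite /p /mixed_powers Defs.pair_of_mxvec_index /= mulrC [RHS]mulrCA [f ^+ a * _]mulrC.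
rewrite shift_poly_char_polyX mulrA -exprD subnKC; last by have := ltn_ord a; lia.
rewrite shift_polyM scalemxAr poly_blocksM poly_blocks_shift shift_polyX.
rewrite -matrix_polyXn -mulmxA [RHS]colE -[RHS]mulmxA -colE; congr (_ *m _).
apply/colP=> k; case/mxvec_indexP: k => i x.
by rewrite poly_blocks_walk [RHS]mxE.
Qed.

(** The determinant of bI - B(X) is f(b) - g(b) X, which is the constant f(b) at a root b of g.
    Hence bI - N has determinant f(b)^n. *)
Lemma det_root_poly (s : seq C) : g = \prod_(b <- s) ('X - b%:P) ->
  \det (matrix_poly g N) = \prod_(b <- s) ((-1) ^+ (n * m) * f.[b] ^+ n).
Proof.
move=> gE; rewrite {1}gE det_matrix_poly_prod big_seq [RHS]big_seq.
apply: eq_bigr => b bs; congr (_ * _).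
have gb0 : g.[b] = 0.
  by apply/eqP; rewrite -/(root g b) gE root_prod_XsubC.
rewrite horner_char_poly -(poly_blocksC m A b) /N -poly_blocksB det_poly_blocks.
by rewrite det_generic_shift -/f -/g gb0 scale0r subr0 matrix_polyC det_scalar.
Qed.

Lemma det_walk_mixed :
  \det (walk_mx N) * \det (mod_mx m f g) ^+ 'C(n, 2) =
  \det (matrix_poly g N) ^+ n.-1 *
    (\det (matrix_poly (walk_det_poly B v) A) * \det (walk_mx A) ^+ m).
Proof.
have /(congr1 determinant) := walk_mixed_powers.
rewrite !det_mulmx det_tr (det_mixed_powers f_monic size_f) ?size_g // => ->.
by rewrite !det_poly_blocks det_mxX det_scalar matrix_polyXn matrix_polyX det_mxX.
Qed.

Lemma det_walk_common_root b : (1 < n)%N -> root f b -> root g b -> \det (walk_mx N) = 0.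
Proof.
move=> n_gt1 /factor_theorem[f1 fE] /factor_theorem[g1 gE].
set d := 'X - b%:P in fE gE.
have d_monic : d \is monic by exact: monicXsubC.
have f1_monic : f1 \is monic by move: f_monic; rewrite fE monicMr.
have g1_monic : g1 \is monic by move: g_monic; rewrite gE monicMr.
have size_f1 : size f1 = m.
  by move: size_f; rewrite fE size_monicM ?monic_neq0 // size_XsubC addn2 => -[].
have size_g1 : (size g1).+1 = m.
  by move: size_g; rewrite gE size_monicM ?monic_neq0 // size_XsubC addn2.
(* With f = f1 d, g = g1 d and l_i the eigenvalues of A, the polynomial
   d * \prod_i (f1 - l_i g1) annihilates N: modulo f(N) = (A (x) I) g(N), the
   product becomes char_poly A evaluated at A. *)
pose Q r := \prod_(l <- r) (f1 - l *: g1).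
have Q_monic r : Q r \is monic /\ size (Q r) = (size r * m.-1).+1.
  elim: r => [|l r [IHm IHs]]; first by rewrite /Q big_nil monic1 size_poly1.
  have szl : (size (- (l *: g1)) < size f1)%N.
    by rewrite size_polyN (leq_ltn_trans (size_scale_leq _ _)) // size_f1 -size_g1.
  have lm : f1 - l *: g1 \is monic by rewrite monicE lead_coefDl.
  rewrite /Q big_cons -/(Q r) monicMl // size_monicM ?monic_neq0 // IHs.
  by rewrite size_polyDl // size_f1 /= addnS /= -{1}(prednK m_gt0) addSn.
have shiftQ r : shift_poly B v (d * Q r) =
    (\prod_(l <- r) ('X - l%:P)) *: shift_poly B v (d * g1 ^+ size r).
  elim: r => [|l r IHr]; first by rewrite /Q !big_nil scale1r.
  rewrite /Q !big_cons -/(Q r) mulrCA shift_polyM IHr -scalemxAr -shift_polyM.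
  (* Multiplied by d, the factor f1 - l g1 becomes f - l g, which at B(X) equals (X - l) g. *)
  rewrite mulrA mulrBl -scalerAl -fE -gE shift_polyM shift_polyB shift_polyZ.
  rewrite shift_poly_char_poly -/g -scalerBl -scalemxAl -shift_polyM scalerA mulrC.
  by rewrite gE [g1 * d]mulrC -mulrA -exprS.
have [r rE] := closed_field_poly_normal (char_poly A).
move: rE; rewrite (monicP (char_poly_monic A)) scale1r => rE.
have size_r : size r = n.
  by have := size_char_poly A; rewrite rE size_prod_XsubC => -[].
pose q := d * Q r.
(* The degree of q is n(m-1) + 1, which is below nm because n > 1. *)
have size_q : (size q <= n * m)%N.
  have [Qm Qs] := Q_monic r.
  rewrite /q size_monicM ?monic_neq0 // size_XsubC Qs size_r add2n /=.
  by rewrite -[X in (_ <= _ * X)%N](prednK m_gt0) mulnS -add2n leq_add2r.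
have q_neq0 : q != 0 by rewrite mulf_neq0 ?monic_neq0 //; have [] := Q_monic r.
have qN : matrix_poly q N = 0.
  rewrite /N -poly_blocks_shift shiftQ -rE poly_blocksZ.
  suff -> : poly_blocks A ((char_poly A)%:M : 'M_m) = 0 by rewrite mul0mx.
  apply: eq_mxvec => i x j y.
  by rewrite poly_blocks_scalar matrix_poly_char_poly !mxE mul0rn.
(* The coefficient vector of q is a nonzero kernel vector of the walk matrix. *)
have := walk_coef_mx N size_q; rewrite qN mul0mx => /(congr1 trmx).
rewrite trmx_mul trmx0 => W0.
apply/eqP; rewrite -det_tr; apply/det0P; exists (\col_s q`_s)^T => //.
apply: contra_neq q_neq0 => /rowP q0; apply/polyP=> s; rewrite coef0.
have [ltsN|] := ltnP s (n * m); first by have := q0 (Ordinal ltsN); rewrite !mxE.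
by move=> les; rewrite nth_default // (leq_trans size_q).
Qed.

Theorem det_walk_generic_shift : exists e,
  \det (walk_mx N) = (-1) ^+ e *
    (root_resultant f g ^+ 'C(n, 2) * \det (matrix_poly (walk_det_poly B v) A)
      * \det (walk_mx A) ^+ m).
Proof.
have gE : g = \prod_(b <- roots_seq g) ('X - b%:P) by exact: roots_seqE.
have [r resE] := root_resultant_sign f_monic g_monic.
move: (roots_seq g) gE resE => s gE; set rho := \prod_(b <- s) f.[b] => resE.
have detT : \det (mod_mx m f g) = (-1) ^+ (m * size s) * rho.
  by rewrite {1}gE det_mod_mx // big_split /= prodr_const_seq exprM.
have detgN : \det (matrix_poly g N) = (-1) ^+ (n * m * size s) * rho ^+ n.
  rewrite (det_root_poly gE) big_split /= prodr_const_seq -exprM.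
  by rewrite prodrXl.
have := det_walk_mixed; rewrite detT detgN.
move: (\det (matrix_poly (walk_det_poly B v) A)) (\det (walk_mx A) ^+ m) => h w.
rewrite resE !exprMn -!exprM.
(* The split is on the power rather than on rho: its vanishing gives both a common root of f and g
   and n > 1. *)
have [rho0 _|rho_neq0] := eqVneq (rho ^+ 'C(n, 2)) 0.
  exists 0; rewrite rho0 mulr0 !mul0r mulr0.
  move/eqP: rho0; rewrite expf_eq0 bin_gt0 => /andP[n_gt1].
  rewrite /rho prodf_seq_eq0 => /hasP[b bs /= fb].
  by apply: (@det_walk_common_root b) => //; rewrite gE root_prod_XsubC.
(* The power of rho from det g(N)^(n-1) is the square of the one on the left, so one copy cancels
   and one remains. *)
have -> : (n * n.-1 = 'C(n, 2) + 'C(n, 2))%N.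
  rewrite addnn bin2 -[LHS]odd_double_half; case: (n) => // k.
  by rewrite oddM /= andNb.
(* The three summands are the signs from det [mod_mx], from det g(N), and from the resultant. *)
move=> detW; exists (m * size s * 'C(n, 2) + n * m * size s * n.-1 + r * 'C(n, 2))%N.
apply: (mulIf rho_neq0).
rewrite !exprD.
have sq k : (-1) ^+ k * (-1) ^+ k = 1 :> C by rewrite -expr2 sqrr_sign.
move: (sq (m * size s * 'C(n, 2))%N) (sq (r * 'C(n, 2))%N) detW.
move: ((-1) ^+ (m * size s * 'C(n, 2))) ((-1) ^+ (r * 'C(n, 2))) => t t' tt tt' detW.
transitivity (t * (\det (walk_mx N) * (t * rho ^+ 'C(n, 2)))).
  by rewrite mulrCA (mulrA t) tt mul1r.
rewrite detW exprD; transitivity (t' * t' * (t * ((-1) ^+ (n * m * size s * n.-1) *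
  (rho ^+ 'C(n, 2) * rho ^+ 'C(n, 2)) * (h * w)))); first by rewrite tt' mul1r.
by ring.
Qed.

End WalkDeterminant.

(** * The rooted product *)

Section MapMorphism.
Variables (R S : comNzRingType) (phi : {rmorphism R -> S}).

Lemma map_matrix_poly k (p : {poly R}) (A : 'M[R]_k) :
  map_mx phi (matrix_poly p A) = matrix_poly (map_poly phi p) (map_mx phi A).
Proof.
elim/poly_ind: p => [|p c IHp]; first by rewrite map_poly0 !matrix_poly0 map_mx0.
rewrite rmorphD rmorphM /= map_polyX map_polyC /= !matrix_polyD !matrix_polyM.
by rewrite !matrix_polyX !matrix_polyC map_mxD map_mxM map_scalar_mx IHp.
Qed.

Lemma map_walk_mx k (A : 'M[R]_k) : map_mx phi (walk_mx A) = walk_mx (map_mx phi A).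
Proof.
apply/matrixP=> i j; rewrite !mxE rmorph_sum; apply: eq_bigr => l _.
have -> : map_mx phi A ^+ j = map_mx phi (A ^+ j).
  elim: (j : nat) => [|s IHs]; first by rewrite !expr0 map_mx1.
  by rewrite !exprS IHs map_mxM.
by rewrite !mxE rmorphM rmorph1.
Qed.

Lemma map_root_shift_mx m (B : 'M[R]_m) (v : 'I_m) c :
  map_mx phi (root_shift_mx B v c) = root_shift_mx (map_mx phi B) v (phi c).
Proof. by rewrite map_mxD map_mxZ map_delta_mx. Qed.

Lemma map_poly_blocks n m (A : 'M[R]_n) (w : 'M[{poly R}]_m) :
  map_mx phi (poly_blocks A w) = poly_blocks (map_mx phi A) (map_mx (map_poly phi) w).
Proof.
apply: eq_mxvec => i x j y.
by rewrite !poly_blocksE !mxE -map_matrix_poly !Defs.pair_of_mxvec_index mxE.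
Qed.

End MapMorphism.

Lemma map_generic_shift (R S : comNzRingType) (phi : {rmorphism R -> S}) m
    (B : 'M[R]_m) (v : 'I_m) :
  map_mx (map_poly phi) (generic_shift B v) = generic_shift (map_mx phi B) v.
Proof.
rewrite map_root_shift_mx /= map_polyX /generic_shift -!map_mx_comp; congr root_shift_mx.
by apply/matrixP=> i j; rewrite !mxE /= map_polyC.
Qed.

Lemma map_walk_det_poly (R S : comNzRingType) (phi : {rmorphism R -> S}) m
    (B : 'M[R]_m) (v : 'I_m) :
  map_poly phi (walk_det_poly B v) = walk_det_poly (map_mx phi B) v.
Proof.
rewrite /walk_det_poly -det_map_mx map_walk_mx; congr (\det (walk_mx _)).
exact: map_generic_shift.
Qed.

(** * The matrix of the rooted product in block form *)

Section RootedProductMatrix.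
Variables (n m : nat) (G : sgraph n) (H : sgraph m) (v : 'I_m).

Lemma rooted_adjE i x j y :
  rooted_product G H v (mxvec_index i x) (mxvec_index j y) =
    (i == j) && H x y || [&& x == v, y == v & G i j].
Proof. by rewrite /= /rooted_adj !Defs.pair_of_mxvec_index. Qed.

(** The two kinds of edges exclude each other since G has no loops, so the disjunction becomes a
    sum. *)
Lemma rooted_adj_natE i x j y :
  (rooted_product G H v (mxvec_index i x) (mxvec_index j y) : nat) =
    ((i == j) * H x y + [&& x == v, y == v & G i j])%N.
Proof.
rewrite rooted_adjE; case: (eqVneq i j) => [<-|_] /=; last by rewrite mul0n.
by rewrite (adj_irrefl G) !andbF orbF mul1n addn0.
Qed.

Lemma deg_sumE k (K : sgraph k) i : deg K i = (\sum_j K i j)%N.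
Proof.
rewrite /deg -sum1_card big_mkcond; apply: eq_bigr => j _; rewrite inE.
by case: (K i j).
Qed.

Lemma deg_rooted_product i x :
  deg (rooted_product G H v) (mxvec_index i x) = (deg H x + (x == v) * deg G i)%N.
Proof.
rewrite !deg_sumE big_mxvec.
transitivity (\sum_j (\sum_y (i == j) * H x y + \sum_y [&& x == v, y == v & G i j]))%N.
  by apply: eq_bigr => j _; rewrite -big_split; apply: eq_bigr => y _; exact: rooted_adj_natE.
rewrite big_split /=; congr (_ + _)%N.
  rewrite (bigD1 i) //= [X in (_ + X)%N]big1 => [|j ji]; last first.
    by rewrite eq_sym (negPf ji) big1.
  by rewrite addn0 eqxx; apply: eq_bigr => y _; rewrite mul1n.
rewrite big_distrr; apply: eq_bigr => j _ /=.
rewrite (bigD1 v) //= big1 => [|y yv]; last by rewrite (negPf yv) andbF.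
by rewrite eqxx addn0 /= -mulnb.
Qed.

(** The adjacency and degree matrices both have the form I (x) X_H + X_G (x) D_v, and this form is
    kept by linear combinations, which covers all three kinds. *)
Lemma graph_mx_rooted_product (R : comNzRingType) (M : mx_kind R) :
  graph_mx M (rooted_product G H v) =
    poly_blocks (graph_mx M G) (generic_shift (graph_mx M H) v).
Proof.
have blockE (A : 'M[R]_n) (B : 'M[R]_m) i x j y :
    poly_blocks A (generic_shift B v) (mxvec_index i x) (mxvec_index j y) =
    B x y *+ (i == j) + A i j *+ ((x == v) && (y == v)).
  rewrite poly_blocksE !mxE matrix_polyD matrix_polyC !mxE; congr (_ + _).
  by case: (_ && _); rewrite ?mulr1 ?matrix_polyX // mulr0 matrix_poly0 mxE.
have adjE i x j y : adj_mx R (rooted_product G H v) (mxvec_index i x) (mxvec_index j y) =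
    adj_mx R H x y *+ (i == j) + adj_mx R G i j *+ ((x == v) && (y == v)).
  rewrite !mxE rooted_adj_natE natrD natrM mulr_natl; congr (_ + _).
  by rewrite andbA -mulnb natrM mulr_natl.
have degE i x j y : deg_mx R (rooted_product G H v) (mxvec_index i x) (mxvec_index j y) =
    deg_mx R H x y *+ (i == j) + deg_mx R G i j *+ ((x == v) && (y == v)).
  rewrite !mxE mxvec_index_inj xpair_eqE deg_rooted_product natrD natrM.
  have [_|ij] := eqVneq i j; last by rewrite !mulr0n mul0rn addr0.
  have [<-|xy] := eqVneq x y; last first.
    rewrite !mulr0n add0r; case: eqP => // xv; case: eqP => // yv.
    by rewrite xv yv eqxx in xy.
  by rewrite /= andbb !mulr1n mulr_natl.
apply: eq_mxvec => i x j y; rewrite blockE; case: M => [||alpha] /=.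
- exact: adjE.
- by rewrite mxE degE adjE !mxE !mulrnDl addrACA.
- have alphaE k (K : sgraph k) a b :
      alpha_mx alpha K a b = alpha * deg_mx R K a b + (1 - alpha) * adj_mx R K a b.
    by rewrite mxE [X in X + _]mxE [X in _ + X]mxE.
  by rewrite !alphaE degE adjE !mulrDr !mulrnAr addrACA !mulrnDl.
Qed.

End RootedProductMatrix.

Theorem theorem3 (R : rcfType) (M : mx_kind R) (n m : nat)
    (G : sgraph n) (H : sgraph m) (v : 'I_m) :
  let MH := graph_mx M H in
  let h := walk_det_poly MH v in
  let lhs := real_complex R
    (\det (walk_mx (graph_mx M (rooted_product G H v)))) in
  let rhs :=
    Res (char_poly MH) (char_poly (delete_vertex_mx MH v))
      ^+ (n * (n - 1) %/ 2)%N
    * real_complex R (\det (matrix_poly h (graph_mx M G)))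
    * real_complex R (\det (walk_mx (graph_mx M G)) ^+ m) in
  lhs = rhs \/ lhs = - rhs.
Proof.
move=> MH h lhs rhs.
set phi := real_complex R : {rmorphism R -> R[i]}.
(* The identity is applied over R[i], where roots and Schur forms exist; all determinants there are
   images of determinants over R. *)
have [e] := det_walk_generic_shift (map_mx phi (graph_mx M G)) (map_mx phi MH) v.
rewrite -map_generic_shift -map_poly_blocks -graph_mx_rooted_product -map_walk_mx det_map_mx.
rewrite -map_walk_det_poly -map_matrix_poly -map_walk_mx !det_map_mx -/h -rmorphXn.
rewrite /delete_vertex_mx -map_col' -map_row' -/(delete_vertex_mx MH v) -!map_char_poly.
rewrite bin2 -divn2 -(subn1 n) -signr_odd => lhsE.
have {lhsE} -> : lhs = (-1) ^+ odd e * rhs by exact: lhsE.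
by case: (odd e); rewrite ?mulN1r ?mul1r; [right|left].
Qed.
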